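(* Let $C_{\mathsf{MSE}}>0$. There exist constants $\kappa>0$, $c_{\mathrm{low}}>0$ and $N_0$, depending only on $C_{\mathsf{MSE}}$, such that for all $d\ge1$, all $n\ge N_0$, every measurable $f\colon(\mathbb R^d)^n\to\mathbb R^d$ that is $(C_{\mathsf{MSE}},\frac dn)$-uniformly MSE-accurate for $\{\mathcal N(\mu,\mathbb I_d)\}_{\mu\in\mathbb R^d}$, and every $\eta\in(0,1)$ with $1\le\lfloor\eta n\rfloor\le\kappa\sqrt n$, we have \[\sup_{\mu\in\mathbb R^d}\mathsf{ES}_{\eta,2}(f;\mu)\ge c_{\mathrm{low}}\,\eta.\]
   Context: For datasets $x,x'\in(\mathbb R^d)^n$, $d_H(x,x')=\#\{i\in[n]: x_i\neq x_i'\}$. For $f\colon(\mathbb R^d)^n\to\mathbb R^d$ and $\eta\in(0,1)$, $S^f_\eta(X)=\sup_{X'\colon d_H(X,X')\le\lfloor\eta n\rfloor}\|f(X)-f(X')\|_2$, and for $q\in\{1,2\}$, $\mathsf{ES}_{\eta,q}(f;\mu)=\big(\mathbb E_{X\sim\mathcal N(\mu,\mathbb I_d)^{\otimes n}}[S^f_\eta(X)^q]\big)^{1/q}$. $f$ is $(C_{\mathsf{MSE}},\frac dn)$-uniformly MSE-accurate if $\sup_{\mu\in\mathbb R^d}\mathbb E_{X\sim\mathcal N(\mu,\mathbb I_d)^{\otimes n}}\|f(X)-\mu\|_2^2\le C_{\mathsf{MSE}}\frac dn$. *)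

(* Defs.v *)
From HB Require Import structures.
From mathcomp Require Import all_boot all_order all_algebra.
From mathcomp Require Import all_classical all_reals all_analysis.
Set Implicit Arguments. Unset Strict Implicit. Unset Printing Implicit Defensive.
Import Order.TTheory GRing.Theory Num.Theory.
Local Open Scope classical_set_scope.
Local Open Scope ring_scope.

Section defs.
Context {R : realType}.

Definition l2norm (d : nat) (v : 'rV[R]_d) : R :=
  Num.sqrt (\sum_(j < d) v ord0 j ^+ 2).

(* A dataset of n points of R^d is an n x d matrix; row i is x_i. *)
Definition hamming (n d : nat) (X X' : 'M[R]_(n, d)) : nat :=
  #|[set i : 'I_n | row i X != row i X']|.

(* Expectation of a [0,+oo]-valued (or \bar R-valued) function of a finite
   list of independent real coordinates, the k-th being N(ms_k, 1)
   (iterated integrals against the one-dimensional normal law). *)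
Fixpoint gauss_int (ms : seq R) (F : seq R -> \bar R) : \bar R :=
  match ms with
  | [::] => F [::]
  | m :: ms' => (\int[normal_prob m 1]_x gauss_int ms' (fun xs => F (x :: xs)))%E
  end.

Definition data_of (n d : nat) (xs : seq R) : 'M[R]_(n, d) :=
  \matrix_(i, j) nth 0 xs (enum_rank ((i, j) : 'I_n * 'I_d)).

Definition gauss_exp (n d : nat) (mu : 'rV[R]_d) (F : 'M[R]_(n, d) -> \bar R)
  : \bar R :=
  gauss_int [seq mu ord0 p.2 | p <- enum {: 'I_n * 'I_d}]
            (fun xs => F (data_of n d xs)).

Definition sens (n d : nat) (f : 'M[R]_(n, d) -> 'rV[R]_d) (eta : R)
  (X : 'M[R]_(n, d)) : \bar R :=
  ereal_sup [set (l2norm (f X - f X'))%:E | X' in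
     [set X' : 'M[R]_(n, d) | (Posz (hamming X X') <= Num.floor (eta * n%:R))%R]].

Definition ES2 (n d : nat) (f : 'M[R]_(n, d) -> 'rV[R]_d) (eta : R)
  (mu : 'rV[R]_d) : \bar R :=
  sqrte (gauss_exp mu (fun X => (sens f eta X ^+ 2)%E)).

Definition unif_MSE_accurate (n d : nat) (C : R) (f : 'M[R]_(n, d) -> 'rV[R]_d)
  : Prop :=
  (ereal_sup [set gauss_exp mu (fun X => ((l2norm (f X - mu)) ^+ 2)%:E)
              | mu in [set: 'rV[R]_d]]
   <= (C * d%:R / n%:R)%:E)%E.

(* Borel measurability of f : (R^d)^n -> R^d: each output coordinate is
   measurable w.r.t. the product sigma-algebra on the (n*d) input coordinates
   (= Borel sigma-algebra of R^{nd}). *)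
Definition measurable_estimator (n d : nat) (f : 'M[R]_(n, d) -> 'rV[R]_d)
  : Prop :=
  forall j : 'I_d,
    measurable_fun [set: #|{: 'I_n * 'I_d}|.-tuple R]
      (fun t => f (data_of n d (tval t)) ord0 j).

End defs.

(* Main.v *)
Require Import Defs.
From HB Require Import structures.
From mathcomp Require Import all_boot all_order all_algebra.
From mathcomp Require Import all_classical all_reals all_analysis.
From mathcomp Require Import measurable_realfun.
From mathcomp Require Import ring lra.
Set Implicit Arguments. Unset Strict Implicit. Unset Printing Implicit Defensive.
Import Order.TTheory GRing.Theory Num.Theory.
Local Open Scope classical_set_scope.
Local Open Scope ring_scope.

(** Put k = floor(eta n), let g be about n/k and arrange the n rows in k groups
    of at most g rows. Choosing one row in each group and moving its j-th
    coordinate by a constant -delta changes at most k rows, so it moves the mean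
    of f_j by at most the sensitivity. Averaged over the choices, the law of the
    moved data is close in chi-square to the Gaussian law whose mean is moved by
    -h = -delta/g in direction j: the two likelihood ratios differ by at most
    10 delta^4 k/g in squared norm, which is of order delta^4 k^2/n when
    k <= sqrt n. Against a mean square error of order 1/n this costs only
    O(delta^2 k/n), less than the shift h ~ delta k/n once delta is small. Hence
    one step of length h changes the mean of f_j by little more than the
    sensitivity. Summing over a large grid of step h and over all j, the means
    must grow by h per step because the bias is bounded; and summing over j uses
    the mean square error through its trace C d/n, so that the dimension
    cancels. *)

(** A nonnegative integral is a supremum over simple functions below the integrand, and a larger
    integrand has more of them. This serves integrands built from the sensitivity, a supremum over
    uncountably many datasets. *)
Lemma ge0_le_integral_nonmeas d (T : measurableType d) (R : realType)
    (mu : {measure set T -> \bar R}) (f g : T -> \bar R) :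
  (forall x, 0 <= f x)%E -> (forall x, f x <= g x)%E ->
  (\int[mu]_x f x <= \int[mu]_x g x)%E.
Proof.
move=> f0 fg; have g0 x : (0 <= g x)%E by exact: le_trans (f0 x) (fg x).
rewrite !ge0_integralTE//; apply: ereal_sup_le => _ /= [h hf <-].
by exists h => // x; exact: le_trans (hf x) (fg x).
Qed.

(** * Translation and tilting of Gaussian laws *)

Section normal.
Context {R : realType}.
Implicit Types (m a : R) (F : R -> \bar R).

Lemma measurable_addr a : measurable_fun [set: R] (fun x : R => x + a).
Proof. exact: measurable_funD. Qed.

Lemma lebesgue_measure_addr a (A : set R) : measurable A ->
  pushforward lebesgue_measure ((fun x => x + a) : R -> measurableTypeR R) A =
  lebesgue_measure A.
Proof.
move=> mA; apply/esym/lebesgue_measure_unique => //=.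
  exact: measurable_addr.
move=> _ _ [[b c]] _ <-.
rewrite /pushforward.
have -> : ((fun x => x + a) : R -> measurableTypeR R) @^-1` `]b, c]%classic =
    `]b - a, c - a]%classic.
  by apply/seteqP; split => x /=; rewrite !in_itv/= ltrBlDr lerBrDr.
rewrite !lebesgue_measure_itv/= !lte_fin ltrD2r.
by case: ifP => // _; rewrite -!EFinB; congr EFin; ring.
Qed.

Lemma ge0_integral_lebesgue_addr a F :
  measurable_fun [set: R] F -> (forall x, 0 <= F x)%E ->
  (\int[lebesgue_measure]_x F (x + a)%R = \int[lebesgue_measure]_x F x)%E.
Proof.
move=> mF F0.
transitivity (\int[pushforward lebesgue_measure
    ((fun x => x + a)%R : R -> measurableTypeR R)]_x F x)%E.
  by rewrite ge0_integral_pushforward//=; exact: measurable_addr.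
apply: eq_measure_integral => //=; first exact: measurable_addr.
by move=> _ A mA _; exact: lebesgue_measure_addr.
Qed.

(** The Radon-Nikodym derivative and [normal_pdf] have the same integral over every measurable set,
    hence agree almost everywhere. *)
Lemma ge0_integral_normal_prob m F :
  measurable_fun [set: R] F -> (forall x, 0 <= F x)%E ->
  (\int[normal_prob m 1]_x F x =
   \int[lebesgue_measure]_x (F x * (normal_pdf m 1 x)%:E))%E.
Proof.
move=> mF F0; pose nu : probability _ R := normal_prob m 1.
have nm : nu `<< @lebesgue_measure R by exact: normal_prob_dominates.
rewrite -(@Radon_Nikodym_SigmaFinite.change_of_variables
  _ _ R nu lebesgue_measure nm F setT)//.
apply: ae_eq_integral => //.
- apply: emeasurable_funM => //; apply: measurable_int.
  exact: Radon_Nikodym_SigmaFinite.f_integrable.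
- apply: emeasurable_funM => //; apply/measurable_EFinP.
  exact: measurable_normal_pdf.
- apply: ae_eqe_mul2l; apply: integral_ae_eq => //.
  + exact: Radon_Nikodym_SigmaFinite.f_integrable.
  + by apply/measurable_EFinP; exact: measurable_normal_pdf.
  + by move=> E _ mE; rewrite -Radon_Nikodym_SigmaFinite.f_integral.
Qed.

Lemma normal_pdf_addr m a x : normal_pdf (m + a) 1 (x + a) = normal_pdf m 1 x.
Proof.
rewrite !normal_pdfE ?oner_eq0// /normal_fun.
by rewrite (_ : x + a - (m + a) = x - m)//; ring.
Qed.

Lemma normal_pdf_tilt m a x :
  normal_pdf (m + a) 1 x = expR (a * (x - m) - a ^+ 2 / 2) * normal_pdf m 1 x.
Proof.
rewrite !normal_pdfE ?oner_eq0// /normal_fun mulrCA -expRD.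
rewrite (_ : - (x - (m + a)) ^+ 2 / (1 ^+ 2 *+ 2) =
  a * (x - m) - a ^+ 2 / 2 + - (x - m) ^+ 2 / (1 ^+ 2 *+ 2))//.
by field.
Qed.

Lemma ge0_integral_normal_addr m a F :
  measurable_fun [set: R] F -> (forall x, 0 <= F x)%E ->
  (\int[normal_prob (m + a)%R 1]_x F x = \int[normal_prob m 1]_x F (x + a)%R)%E.
Proof.
move=> mF F0.
rewrite [LHS]ge0_integral_normal_prob//.
rewrite [RHS]ge0_integral_normal_prob; last 2 first.
- exact: (measurableT_comp mF (measurable_addr a)).
- by move=> x; exact: F0.
rewrite -[LHS](ge0_integral_lebesgue_addr a).
- by apply: eq_integral => x _; rewrite normal_pdf_addr.
- apply: emeasurable_funM => //; apply/measurable_EFinP.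
  exact: measurable_normal_pdf.
- by move=> x; rewrite mule_ge0// lee_fin normal_pdf_ge0.
Qed.

Lemma ge0_integral_normal_tilt m a F :
  measurable_fun [set: R] F -> (forall x, 0 <= F x)%E ->
  (\int[normal_prob (m + a)%R 1]_x F x =
   \int[normal_prob m 1]_x (F x * (expR (a * (x - m) - a ^+ 2 / 2)%R)%:E))%E.
Proof.
move=> mF F0; rewrite [LHS]ge0_integral_normal_prob//.
rewrite [RHS]ge0_integral_normal_prob//; last 2 first.
- apply: emeasurable_funM => //; apply/measurable_EFinP.
  apply: measurableT_comp => //; apply: measurable_funB => //.
  by apply: measurable_funM => //; exact: measurable_funB.
- by move=> x; rewrite mule_ge0// lee_fin expR_ge0.
by apply: eq_integral => x _; rewrite normal_pdf_tilt EFinM muleA.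
Qed.

End normal.

(** * Products of one-dimensional Gaussian laws *)

Section gauss_prod.
Context {R : realType}.
Implicit Types (N : nat) (m a b : nat -> R).

Definition tcons N (z : measurableTypeR R * N.-tuple R) : N.+1.-tuple R :=
  [tuple of z.1 :: z.2].

Lemma measurable_tcons N :
  measurable_fun [set: measurableTypeR R * N.-tuple R] (@tcons N).
Proof.
apply: (@measurable_cons _ _ _ R (fun z => z.1 : R) _ snd) => //.
exact: (@measurable_fst _ _ (measurableTypeR R) (N.-tuple R)).
Qed.

HB.instance Definition _ N :=
  isMeasurableFun.Build _ _ _ _ (@tcons N) (@measurable_tcons N).

Definition cons_prob N (P : probability (measurableTypeR R) R)
    (Q : probability (N.-tuple R) R) : probability (N.+1.-tuple R) R :=
  distribution (P \x Q)%E (@tcons N).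

(* Only the first [N] values of the sequence of means matter. *)
Fixpoint gauss_prod N : (nat -> R) -> probability (N.-tuple R) R :=
  match N with
  | 0 => fun _ => dirac [tuple]
  | N'.+1 => fun m => cons_prob (normal_prob (m 0%N) 1) (gauss_prod N' (m \o S))
  end.

Lemma ge0_integral_gauss_prod0 m (F : 0.-tuple R -> \bar R) :
  measurable_fun [set: 0.-tuple R] F -> (forall t, 0 <= F t)%E ->
  (\int[gauss_prod 0 m]_t F t = F [tuple])%E.
Proof. by move=> mF F0; rewrite integral_dirac// diracT mul1e. Qed.

Lemma ge0_integral_gauss_prodS N m (F : N.+1.-tuple R -> \bar R) :
  measurable_fun [set: N.+1.-tuple R] F -> (forall t, 0 <= F t)%E ->
  (\int[gauss_prod N.+1 m]_t F t =
   \int[normal_prob (m 0%N) 1]_x \int[gauss_prod N (m \o S)]_t F (tcons (x, t)))%E.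
Proof.
move=> mF F0; rewrite [LHS]ge0_integral_distribution// fubini_tonelli1//.
  exact: measurableT_comp.
by move=> z; exact: F0.
Qed.

Lemma measurable_slice N (F : N.+1.-tuple R -> \bar R) x :
  measurable_fun [set: N.+1.-tuple R] F ->
  measurable_fun [set: N.-tuple R] (fun t => F (tcons (x, t))).
Proof.
by move=> mF; apply: measurableT_comp => //; exact: measurableT_comp.
Qed.

Lemma measurable_integral_slice N m (F : N.+1.-tuple R -> \bar R) :
  measurable_fun [set: N.+1.-tuple R] F -> (forall t, 0 <= F t)%E ->
  measurable_fun [set: R] (fun x => \int[gauss_prod N m]_t F (tcons (x, t)))%E.
Proof.
move=> mF F0.
apply: (@measurable_fun_fubini_tonelli_F _ _ _ _ _ (gauss_prod N m)
  (F \o @tcons N)) => //.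
  exact: measurableT_comp.
by move=> z; exact: F0.
Qed.

(* Only the minorant [H] has to be measurable: the sensitivity need not be. *)
Lemma le_gauss_int ms (G : seq R -> \bar R) (H : (size ms).-tuple R -> \bar R) :
  measurable_fun [set: (size ms).-tuple R] H -> (forall t, 0 <= H t)%E ->
  (forall t : (size ms).-tuple R, H t <= G t)%E ->
  (\int[gauss_prod (size ms) (nth 0%R ms)]_t H t <= gauss_int ms G)%E.
Proof.
elim: ms G H => [|m ms IH] G H mH H0 HG.
  by rewrite ge0_integral_gauss_prod0//; exact: (HG [tuple]).
rewrite [X in (X <= _)%E]ge0_integral_gauss_prodS//=.
apply: ge0_le_integral_nonmeas => x.
  by apply: integral_ge0.
apply: (IH (fun xs => G (x :: xs)) (fun t => H (tcons (x, t)))) => //.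
  exact: measurable_slice.
by move=> t; apply: HG.
Qed.

Definition tshift N a (t : N.-tuple R) : N.-tuple R :=
  [tuple tnth t i + a i | i < N].

Lemma measurable_tshift N a : measurable_fun [set: N.-tuple R] (@tshift N a).
Proof.
apply/measurable_fun_tnthP => i.
rewrite (_ : _ \o _ = (fun t => tnth t i + a i)); last first.
  by apply/funext => t /=; rewrite tnth_mktuple.
apply: measurable_funD => //; exact: measurable_tnth.
Qed.

Lemma tshift_tcons N a x (t : N.-tuple R) :
  tshift a (tcons (x, t)) = tcons (x + a 0%N, tshift (a \o S) t).
Proof.
apply: eq_from_tnth => i; rewrite tnth_mktuple; case: (unliftP ord0 i) => [j ->|->].
  by rewrite !tnthS tnth_mktuple.
by rewrite !tnth0.
Qed.

(** Density of the product Gaussian law with means [m + a] relative to the one with means [m]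
    (Cameron-Martin). *)
Definition tilt N m a (t : N.-tuple R) : R :=
  \prod_(i < N) expR (a i * (tnth t i - m i) - a i ^+ 2 / 2).

Lemma tilt_tcons N m a x (t : N.-tuple R) :
  tilt m a (tcons (x, t)) =
  expR (a 0%N * (x - m 0%N) - a 0%N ^+ 2 / 2) * tilt (m \o S) (a \o S) t.
Proof.
rewrite /tilt big_ord_recl tnth0; congr (_ * _).
by apply: eq_bigr => i _; rewrite tnthS.
Qed.

Lemma measurable_tilt N m a : measurable_fun [set: N.-tuple R] (tilt m a).
Proof.
apply: measurable_prod => i _; apply: measurableT_comp => //.
apply: measurable_funB => //; apply: measurable_funM => //.
by apply: measurable_funB => //; exact: measurable_tnth.
Qed.

Lemma tilt_gt0 N m a (t : N.-tuple R) : 0 < tilt m a t.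
Proof. by apply: prodr_gt0 => i _; exact: expR_gt0. Qed.

Lemma ge0_integral_gauss_prod_shift N m a (F : N.-tuple R -> \bar R) :
  measurable_fun [set: N.-tuple R] F -> (forall t, 0 <= F t)%E ->
  (\int[gauss_prod N (fun i => m i + a i)%R]_t F t =
   \int[gauss_prod N m]_t F (tshift a t))%E.
Proof.
elim: N m a F => [|N IH] m a F mF F0.
  rewrite !ge0_integral_gauss_prod0//; last first.
    by apply: measurableT_comp => //; exact: measurable_tshift.
  by congr F; apply: eq_from_tnth; case.
have mFa : measurable_fun [set: N.+1.-tuple R] (fun t => F (tshift a t)).
  by apply: measurableT_comp => //; exact: measurable_tshift.
apply: (etrans (ge0_integral_gauss_prodS _ mF F0)).
apply: (etrans _ (esym (ge0_integral_gauss_prodS m mFa (fun t => F0 _)))).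
rewrite [LHS]ge0_integral_normal_addr; last 2 first.
- exact: measurable_integral_slice.
- by move=> x; exact: integral_ge0.
apply: eq_integral => x _.
under [RHS]eq_integral do rewrite tshift_tcons.
by apply: (IH (m \o S) (a \o S)) => //; exact: measurable_slice.
Qed.

Lemma ge0_integral_gauss_prod_tilt N m a (F : N.-tuple R -> \bar R) :
  measurable_fun [set: N.-tuple R] F -> (forall t, 0 <= F t)%E ->
  (\int[gauss_prod N (fun i => m i + a i)%R]_t F t =
   \int[gauss_prod N m]_t (F t * (tilt m a t)%:E))%E.
Proof.
have mFt N' m' a' (F' : N'.-tuple R -> \bar R) :
    measurable_fun [set: N'.-tuple R] F' ->
    measurable_fun [set: N'.-tuple R] (fun t => F' t * (tilt m' a' t)%:E)%E.
  move=> mF'; apply: emeasurable_funM => //; apply/measurable_EFinP.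
  exact: measurable_tilt.
elim: N m a F => [|N IH] m a F mF F0.
  rewrite !ge0_integral_gauss_prod0//; last 2 first.
  - exact: mFt.
  - by move=> t; rewrite mule_ge0// lee_fin ltW// tilt_gt0.
  by rewrite /tilt big_ord0 mule1.
have F1 t : (0 <= F t * (tilt m a t)%:E)%E.
  by rewrite mule_ge0// lee_fin ltW// tilt_gt0.
apply: (etrans (ge0_integral_gauss_prodS _ mF F0)).
apply: (etrans _ (esym (ge0_integral_gauss_prodS m (mFt _ m a _ mF) F1))).
rewrite [LHS]ge0_integral_normal_tilt; last 2 first.
- exact: measurable_integral_slice.
- by move=> x; exact: integral_ge0.
apply: eq_integral => x _.
have mFx := measurable_slice x mF.
rewrite (IH (m \o S) (a \o S))//.
rewrite -ge0_integralZr//.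
- by apply: eq_integral => t _; rewrite tilt_tcons -muleA -EFinM mulrC.
- exact: mFt.
- by move=> t _; rewrite mule_ge0// lee_fin ltW// tilt_gt0.
Qed.

End gauss_prod.

(** * Integrability of products and finite sums *)

Section integrable_aux.
Context d (T : measurableType d) (R : realType) (mu : {measure set T -> \bar R}).

Lemma integrableM_sq (F G : T -> R) :
  measurable_fun [set: T] F -> measurable_fun [set: T] G ->
  mu.-integrable [set: T] (fun t => (F t ^+ 2)%:E) ->
  mu.-integrable [set: T] (fun t => (G t ^+ 2)%:E) ->
  mu.-integrable [set: T] (fun t => (F t * G t)%:E).
Proof.
move=> mF mG iF iG; apply: le_integrable (integrableD measurableT iF iG) => //.
  by apply/measurable_EFinP; exact: measurable_funM.
move=> t _; rewrite -EFinD !abse_EFin lee_fin.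
rewrite [leRHS]ger0_norm ?addr_ge0 ?sqr_ge0// ler_norml.
have := sqr_ge0 (F t - G t); have := sqr_ge0 (F t + G t).
by have := sqr_ge0 (F t); have := sqr_ge0 (G t); lra.
Qed.

Lemma Rintegral_sum (I : Type) (s : seq I) (f : I -> T -> R) :
  (forall i, mu.-integrable [set: T] (fun t => (f i t)%:E)) ->
  \int[mu]_t (\sum_(i <- s) f i t) = \sum_(i <- s) \int[mu]_t f i t.
Proof.
move=> fi; rewrite /Rintegral.
under eq_integral do rewrite -sumEFin.
rewrite (integral_sum measurableT fi) (eq_bigr (fun i => (\int[mu]_t f i t)%:E)).
  by rewrite sumEFin.
by move=> i _; rewrite fineK//; exact: integrable_fin_num.
Qed.

End integrable_aux.

(** * Likelihood ratios and their Gram matrix *)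

Section gauss_prod_signed.
Context {R : realType} (N : nat).
Implicit Types (m a b : nat -> R) (F G : N.-tuple R -> R).

Lemma integral_gauss_prod_shift m a (F : N.-tuple R -> \bar R) :
  measurable_fun [set: N.-tuple R] F ->
  (\int[gauss_prod N (fun i => m i + a i)%R]_t F t =
   \int[gauss_prod N m]_t F (tshift a t))%E.
Proof.
move=> mF; rewrite [LHS]integralE [RHS]integralE; congr (_ - _)%E.
  rewrite ge0_integral_gauss_prod_shift//; last exact: measurable_funepos.
  by apply: eq_integral => t _; rewrite !funeposE.
rewrite ge0_integral_gauss_prod_shift//; last exact: measurable_funeneg.
by apply: eq_integral => t _; rewrite !funenegE.
Qed.

Lemma integral_gauss_prod_tilt m a (F : N.-tuple R -> \bar R) :
  measurable_fun [set: N.-tuple R] F ->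
  (\int[gauss_prod N (fun i => m i + a i)%R]_t F t =
   \int[gauss_prod N m]_t (F t * (tilt m a t)%:E))%E.
Proof.
have tilt0 (t : N.-tuple R) : 0 <= tilt m a t by rewrite ltW// tilt_gt0.
move=> mF; rewrite [LHS]integralE [RHS]integralE; congr (_ - _)%E.
  rewrite ge0_integral_gauss_prod_tilt//; last exact: measurable_funepos.
  apply: eq_integral => t _.
  by rewrite !funeposE maxe_pMl ?lee_fin// mul0e.
rewrite ge0_integral_gauss_prod_tilt//; last exact: measurable_funeneg.
apply: eq_integral => t _.
by rewrite !funenegE maxe_pMl ?lee_fin// mul0e mulNe.
Qed.

Lemma tilt_tshift m a b (t : N.-tuple R) :
  tilt m b (tshift a t) = expR (\sum_(i < N) a i * b i) * tilt m b t.
Proof.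
rewrite (big_morph _ (@expRD R) (@expR0 R)) /tilt -big_split /=.
by apply: eq_bigr => i _; rewrite tnth_mktuple -expRD; congr expR; ring.
Qed.

(** The factor [tilt m a] moves the mean to [m + a]. Translating back by [a] multiplies [tilt m b],
    which has integral 1, by the exponential of the inner product. These Gram entries make
    chi-square norms computable. *)
Lemma integral_tiltM m a b :
  (\int[gauss_prod N m]_t (tilt m a t * tilt m b t)%:E =
   (expR (\sum_(i < N) a i * b i))%:E)%E.
Proof.
have mt c : measurable_fun [set: N.-tuple R] (fun t => (tilt m c t)%:E).
  by apply/measurable_EFinP; exact: measurable_tilt.
have int1 : (\int[gauss_prod N m]_t (tilt m b t)%:E = 1)%E.
  under eq_integral do rewrite -[X in X%:E]mul1r EFinM.
  rewrite -integral_gauss_prod_tilt//.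
  rewrite integral_cst// mul1e.
  exact: (@probability_setT _ _ _ (gauss_prod N _)).
under eq_integral do rewrite mulrC EFinM.
rewrite -integral_gauss_prod_tilt// integral_gauss_prod_shift//.
under eq_integral do rewrite tilt_tshift EFinM.
rewrite ge0_integralZl//; first by rewrite int1 mule1.
by move=> t _; rewrite lee_fin ltW// tilt_gt0.
Qed.

Lemma integrable_tiltM m a b :
  (gauss_prod N m).-integrable [set: N.-tuple R]
    (fun t => (tilt m a t * tilt m b t)%:E).
Proof.
apply/integrableP; split.
  by apply/measurable_EFinP/measurable_funM; exact: measurable_tilt.
under eq_integral do rewrite gee0_abs ?lee_fin ?mulr_ge0 ?ltW ?tilt_gt0//.
by rewrite integral_tiltM ltry.
Qed.

Section square_integrable.
Variables (m : nat -> R) (G : N.-tuple R -> R).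
Hypothesis mG : measurable_fun [set: N.-tuple R] G.
Hypothesis iG : (gauss_prod N m).-integrable [set: N.-tuple R]
  (fun t => (G t ^+ 2)%:E).
Let P := gauss_prod N m.

Lemma integrable_mul_tilt a :
  P.-integrable [set: N.-tuple R] (fun t => (G t * tilt m a t)%:E).
Proof.
apply: integrableM_sq => //; first exact: measurable_tilt.
under eq_fun do rewrite expr2.
exact: integrable_tiltM.
Qed.

(** Passing to the shifted law and then to its density gives the integral of [|G|] times [tilt m a],
    finite because both factors are square integrable. *)
Lemma integrable_tshift a :
  P.-integrable [set: N.-tuple R] (fun t => (G (tshift a t))%:E).
Proof.
have mGa : measurable_fun [set: N.-tuple R] (fun t => G (tshift a t)).
  by apply: measurableT_comp => //; exact: measurable_tshift.
apply/integrableP; split; first exact/measurable_EFinP.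
rewrite -(@integral_gauss_prod_shift m a (fun t => `|(G t)%:E|)%E); last first.
  by apply: measurableT_comp => //; exact/measurable_EFinP.
rewrite integral_gauss_prod_tilt; last first.
  by apply: measurableT_comp => //; exact/measurable_EFinP.
have /integrableP[_] := integrable_mul_tilt a.
under eq_integral do rewrite EFinM abseM [X in (_ * X)%E]gee0_abs
  ?lee_fin ?ltW ?tilt_gt0//.
by [].
Qed.

Lemma Rintegral_tshift a :
  \int[P]_t G (tshift a t) = \int[P]_t (G t * tilt m a t).
Proof.
rewrite /Rintegral -(@integral_gauss_prod_shift m a (EFin \o G)); last first.
  exact/measurable_EFinP.
rewrite integral_gauss_prod_tilt; last exact/measurable_EFinP.
by [].
Qed.

(* Weighted AM-GM applied to the product of [G] with the signed combination of
   likelihood ratios; the double sum is the squared norm of that combination. *)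
Lemma sum_Rintegral_tshift_le (K : finType) (c : K -> R) (th : K -> nat -> R)
    (lam : R) : 0 < lam ->
  \sum_k c k * \int[P]_t G (tshift (th k) t) <=
  lam / 2 * \int[P]_t (G t ^+ 2) +
  (\sum_k \sum_l c k * c l * expR (\sum_(i < N) th k i * th l i)) / (2 * lam).
Proof.
move=> lam0.
pose D (t : N.-tuple R) := \sum_k c k * tilt m (th k) t.
have mD : measurable_fun [set: N.-tuple R] D.
  apply: measurable_sum => k; apply: measurable_funM => //.
  exact: measurable_tilt.
have icc k l : P.-integrable [set: N.-tuple R]
    (fun t => (c k * c l * (tilt m (th k) t * tilt m (th l) t))%:E).
  under eq_fun do rewrite EFinM.
  by apply: integrableZl => //; exact: integrable_tiltM.
have D2E : (fun t => D t ^+ 2) =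
    fun t => \sum_k \sum_l c k * c l * (tilt m (th k) t * tilt m (th l) t).
  apply/funext => t; rewrite expr2 /D mulr_suml; apply: eq_bigr => k _.
  by rewrite mulr_sumr; apply: eq_bigr => l _; rewrite mulrACA.
have icl k : P.-integrable [set: N.-tuple R]
    (fun t => (\sum_l c k * c l * (tilt m (th k) t * tilt m (th l) t))%:E).
  under eq_fun do rewrite -sumEFin.
  by apply: integrable_sum => // l _; exact: icc.
have iD2 : P.-integrable [set: N.-tuple R] (fun t => (D t ^+ 2)%:E).
  under eq_fun do rewrite (congr1 (@^~ _) D2E) -sumEFin.
  by apply: integrable_sum => // k _; exact: icl.
have D2int : \int[P]_t (D t ^+ 2) =
    \sum_k \sum_l c k * c l * expR (\sum_(i < N) th k i * th l i).
  rewrite [X in Rintegral _ _ X]D2E Rintegral_sum//; apply: eq_bigr => k _.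
  rewrite Rintegral_sum//; apply: eq_bigr => l _.
  rewrite RintegralZl//; last exact: integrable_tiltM.
  by rewrite /Rintegral integral_tiltM.
have iGD : P.-integrable [set: N.-tuple R] (fun t => (G t * D t)%:E).
  exact: integrableM_sq.
have -> : \sum_k c k * \int[P]_t G (tshift (th k) t) = \int[P]_t (G t * D t).
  have -> : (fun t => G t * D t) = fun t => \sum_k c k * (G t * tilt m (th k) t).
    by apply/funext => t; rewrite mulr_sumr; apply: eq_bigr => k _; rewrite mulrCA.
  rewrite Rintegral_sum; last first.
    move=> k; under eq_fun do rewrite EFinM.
    by apply: integrableZl => //; exact: integrable_mul_tilt.
  apply: eq_bigr => k _; rewrite RintegralZl//; last exact: integrable_mul_tilt.
  by rewrite Rintegral_tshift.
have iZ r (F : N.-tuple R -> R) :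
    P.-integrable [set: N.-tuple R] (fun t => (F t)%:E) ->
    P.-integrable [set: N.-tuple R] (fun t => (r * F t)%:E).
  by move=> iF; under eq_fun do rewrite EFinM; exact: integrableZl.
rewrite -D2int [X in _ + X]mulrC -!RintegralZl// -RintegralD//; last 2 first.
- exact: (iZ _ (fun t => G t ^+ 2)).
- exact: (iZ _ (fun t => D t ^+ 2)).
apply: le_Rintegral => //.
  exact: (integrableD measurableT (iZ (lam / 2) (fun t => G t ^+ 2) iG)
    (iZ (2 * lam)^-1 (fun t => D t ^+ 2) iD2)).
move=> t _; rewrite -subr_ge0.
have -> : lam / 2 * G t ^+ 2 + (2 * lam)^-1 * D t ^+ 2 - G t * D t =
    (lam * G t - D t) ^+ 2 / (2 * lam) by field; rewrite gt_eqF.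
by rewrite divr_ge0 ?sqr_ge0// mulr_ge0// ltW.
Qed.

End square_integrable.
End gauss_prod_signed.

(** * One row in each group *)

Lemma big_option (V : nmodType) (T : finType) (F : option T -> V) :
  \sum_x F x = F None + \sum_x F (Some x).
Proof.
rewrite (bigD1 None)//=; congr (_ + _).
rewrite (reindex_omap Some id); last by case.
by apply: eq_bigl => j; rewrite eqxx.
Qed.

Section transversal.
Variables (I J Q : finType) (r : I -> J) (q : I -> Q).
Hypothesis rq_inj : injective (fun i => (r i, q i)).
Context {R : realType}.
Implicit Types a b : {ffun J -> Q}.

(* [r i] is the group of the row [i] and [q i] its place in that group; [a]
   chooses a place in every group, which may be empty. *)
Definition transv a : {set I} := [set i | a (r i) == q i].

(** The group and the chosen place determine the row, so each group gives at most one. *)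
Lemma card_transv a : (#|transv a| <= #|J|)%N.
Proof.
rewrite -(card_in_imset (f := r)) ?max_card// => i i'.
rewrite !inE => /eqP ai /eqP ai' rii'; apply: rq_inj.
by rewrite -ai -ai' rii'.
Qed.

(** A row common to both selections lies in a group where [a] and [b] agree, and each such group
    gives at most one. *)
Lemma card_transvI a b :
  (#|transv a :&: transv b| <= #|[set j | a j == b j]%SET|)%N.
Proof.
rewrite -(card_in_imset (f := r)).
  apply: subset_leq_card; apply/fintype.subsetP => _ /imsetP[i + ->].
  rewrite !inE => /andP[/eqP ai /eqP bi].
  by rewrite ai bi.
move=> i i'; rewrite !inE => /andP[/eqP ai _] /andP[/eqP ai' _] rii'.
by apply: rq_inj; rewrite -ai -ai' rii'.
Qed.

Lemma card_ffun_fix (j : J) (x : Q) :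
  (#|[set a : {ffun J -> Q} | a j == x]%SET| * #|Q| = #|{ffun J -> Q}|)%N.
Proof.
rewrite card_ffun -sum1dep_card.
rewrite (eq_bigl (fun a : {ffun J -> Q} =>
  a \in family (fun i => if i == j then pred1 x else predT))); last first.
  move=> a; rewrite [LHS]inE; apply/eqP/familyP => [ajx i|/(_ j)].
    by case: eqVneq => [->|//]; rewrite inE ajx.
  by rewrite eqxx inE => /eqP.
rewrite sum1_card card_family foldrE big_map big_enum/= (bigD1 j)//= eqxx card1 mul1n.
rewrite (eq_bigr (fun=> #|Q|)); last by move=> i /negbTE->.
by rewrite prod_nat_const cardC1 -expnSr prednK//; apply/card_gt0P; exists j.
Qed.

(** Double counting: each row is selected by a fraction [1 / #|Q|] of the choices. *)
Lemma sum_card_transv :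
  ((\sum_a #|transv a|) * #|Q| = #|I| * #|{ffun J -> Q}|)%N.
Proof.
have -> : (\sum_a #|transv a| =
    \sum_i #|[set a : {ffun J -> Q} | a (r i) == q i]%SET|)%N.
  rewrite /transv; under eq_bigr do rewrite -sum1dep_card big_mkcond.
  rewrite exchange_big; apply: eq_bigr => i _.
  by rewrite -sum1dep_card [RHS]big_mkcond.
rewrite big_distrl -sum_nat_const; apply: eq_bigr => i _ /=.
exact: card_ffun_fix.
Qed.

(** For fixed [a] the sum over [b] factors over the groups: in each, one value agrees with [a] and
    has weight [expR s], the other [#|Q| - 1] have weight 1. *)
Lemma sum_exp_agree (s : R) :
  \sum_(a : {ffun J -> Q}) \sum_(b : {ffun J -> Q})
    expR (s * #|[set j | a j == b j]%SET|%:R) =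
  #|{ffun J -> Q}|%:R * (#|Q|%:R + (expR s - 1)) ^+ #|J|.
Proof.
pose w (b : bool) := if b then expR s else 1.
have E (a b : {ffun J -> Q}) :
    expR (s * #|[set j | a j == b j]%SET|%:R) = \prod_j w (a j == b j).
  rewrite -sum1dep_card natr_sum mulr_sumr expR_sum big_mkcond/=.
  by apply: eq_bigr => j _; rewrite /w mulr1; case: ifP.
under eq_bigr => a _ do (under eq_bigr => b _ do rewrite E;
  rewrite -(bigA_distr_bigA (fun j x => w (a j == x)))).
rewrite mulr_natl -sumr_const; apply: eq_bigr => a _.
rewrite -[in RHS]prodr_const; apply: eq_bigr => j _.
rewrite (bigD1 (a j))//= eqxx (eq_bigr (fun=> 1)); last first.
  by move=> x; rewrite eq_sym => /negbTE->.
rewrite sumr_const cardC1 /w.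
have : (0 < #|Q|)%N by apply/card_gt0P; exists (a j).
by case: #|Q| => // n _; rewrite /= -[n.+1]addn1 natrD; ring.
Qed.

End transversal.

(** * Numerical bounds for the exponential *)

Section expR_bounds.
Context {R : realType}.

(** From [expR (- x) >= 1 - x] comes [expR x <= 1 / (1 - x)], and [(1 + x + 2 x^2) (1 - x) = 1 + x^2
    (1 - 2 x) >= 1]. *)
Lemma expR_le_quad (x : R) : 0 <= x <= 1 / 2 -> expR x <= 1 + x + 2 * x ^+ 2.
Proof.
move=> /andP[x0 x1]; have h := expR_ge1Dx (- x).
have e1 : expR x * expR (- x) = 1 by rewrite -expRD subrr expR0.
have e0 := expR_gt0 x.
have le1 : expR x * (1 - x) <= 1 by rewrite -[leRHS]e1 ler_pM2l.
rewrite -(@ler_pM2r _ (1 - x)); last by lra.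
apply: (le_trans le1); have := sqr_ge0 x; nra.
Qed.

(** With [t = k / g] and [u = n s / g^2] the constants cancel and the linear terms leave [t s - u].
    The total is at most [(1 + 2 + 2 + 9/2) t s^2], coming in turn from [t s - u], from [2 u^2],
    from the quadratic part of [expR s - 1], and from [2 (t s + 2 t s^2)^2]. *)
Lemma mix_exp_bound (s k g n : R) :
  0 <= s <= 1 / 4 -> 0 < g -> 1 / g <= s -> 0 <= k -> k <= g -> k * (g - 1) <= n ->
  n <= k * g ->
  expR (n * s / g ^+ 2) - 2 * (1 + n * s / g ^+ 2) +
    expR (k / g * (expR s - 1)) <= 10 * (k / g) * s ^+ 2.
Proof.
move=> /andP[s0 s1] g0 gs k0 kg knl knu.
set t := k / g; set u := n * s / g ^+ 2.
have t0 : 0 <= t by rewrite divr_ge0// ltW.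
have t1 : t <= 1 by rewrite ler_pdivrMr// mul1r.
have u_le : u <= t * s.
  rewrite /u /t ler_pdivrMr ?exprn_gt0//.
  rewrite (_ : k / g * s * g ^+ 2 = k * g * s); last by field; rewrite gt_eqF.
  by rewrite ler_wpM2r.
(* Rounding error: [k g - n <= k], and [1 / g <= s] supplies the second factor [s]. *)
have u_ge : t * s - u <= t * s ^+ 2.
  have -> : t * s - u = (k * g - n) / g ^+ 2 * s.
    by rewrite /t /u; field; rewrite gt_eqF.
  rewrite expr2 mulrA ler_wpM2r//.
  apply: (@le_trans _ _ (k / g ^+ 2)).
    by rewrite ler_wpM2r ?invr_ge0 ?sqr_ge0//; lra.
  by rewrite (_ : k / g ^+ 2 = t * (1 / g)) ?ler_wpM2l// /t; field; rewrite gt_eqF.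
have n0 : 0 <= n.
  apply: le_trans knl; rewrite mulr_ge0// subr_ge0.
  by move: gs; rewrite ler_pdivrMr// => gs; nra.
have u0 : 0 <= u by rewrite divr_ge0 ?mulr_ge0 ?exprn_ge0// ltW.
have e1 : expR u <= 1 + u + 2 * u ^+ 2.
  by apply: expR_le_quad; apply/andP; split=> //; nra.
have y0 : 0 <= expR s - 1 by rewrite subr_ge0 -expR0 ler_expR.
have y1 : expR s - 1 <= s + 2 * s ^+ 2.
  have : expR s <= 1 + s + 2 * s ^+ 2.
    by apply: expR_le_quad; apply/andP; split; lra.
  by lra.
have e2 : expR (t * (expR s - 1)) <=
    1 + (t * s + 2 * t * s ^+ 2) + 2 * (t * s + 2 * t * s ^+ 2) ^+ 2.
  apply: (@le_trans _ _ (expR (t * s + 2 * t * s ^+ 2))).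
    by rewrite ler_expR; nra.
  by apply: expR_le_quad; apply/andP; split; nra.
have ts1 : 0 <= t * s by rewrite mulr_ge0.
have u2 : u ^+ 2 <= t * s ^+ 2 by nra.
have z2 : (t * s + 2 * t * s ^+ 2) ^+ 2 <= 9 / 4 * (t * s ^+ 2).
  have w : t * (1 + 2 * s) ^+ 2 <= 9 / 4.
    by apply: (@le_trans _ _ ((1 + 2 * s) ^+ 2)); [rewrite ler_piMl ?sqr_ge0|nra].
  rewrite (_ : (_ + _) ^+ 2 = t * s ^+ 2 * (t * (1 + 2 * s) ^+ 2)); last by ring.
  by rewrite [leRHS]mulrC; apply: ler_wpM2l => //; rewrite mulr_ge0 ?sqr_ge0.
lra.
Qed.

End expR_bounds.

(** The inequality [|D| <= E / 2 + D^2 / (2 E)] gives integrability and, integrated against a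
    probability, the bound [E]. *)
Lemma normr_Rintegral_le_of_sq d (T : measurableType d) (R : realType)
    (P : probability T R) (D : T -> R) (E : R) :
  measurable_fun [set: T] D -> 0 < E ->
  (\int[P]_t (D t ^+ 2)%:E <= (E ^+ 2)%:E)%E ->
  P.-integrable [set: T] (fun t => (D t)%:E) /\ `|\int[P]_t D t| <= E.
Proof.
move=> mD E0 leE.
have iD2 : P.-integrable [set: T] (fun t => (D t ^+ 2)%:E).
  apply/integrableP; split; first by apply/measurable_EFinP; exact: measurable_funX.
  under eq_integral do rewrite gee0_abs ?lee_fin ?sqr_ge0//.
  by apply: le_lt_trans leE _; rewrite ltry.
have iZ : P.-integrable [set: T] (fun t => ((2 * E)^-1 * D t ^+ 2)%:E).
  by under eq_fun do rewrite EFinM; exact: integrableZl.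
have iM : P.-integrable [set: T] (fun t => (E / 2 + (2 * E)^-1 * D t ^+ 2)%:E).
  exact: (integrableD measurableT
    (finite_measure_integrable_cst _ (E / 2) measurableT) iZ).
have amgm t : `|D t| <= E / 2 + (2 * E)^-1 * D t ^+ 2.
  rewrite -real_normK ?num_real// -subr_ge0.
  have -> : E / 2 + (2 * E)^-1 * `|D t| ^+ 2 - `|D t| = (E - `|D t|) ^+ 2 / (2 * E).
    by field; rewrite gt_eqF.
  by rewrite divr_ge0 ?sqr_ge0// mulr_ge0// ltW.
have iD : P.-integrable [set: T] (fun t => (D t)%:E).
  apply: le_integrable iM => //; first exact/measurable_EFinP.
  move=> t _; rewrite !abse_EFin lee_fin.
  by apply: le_trans (amgm t) _; exact: ler_norm.
split=> //.
have iN : P.-integrable [set: T] (EFin \o (fun t => `|D t|)).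
  exact: (integrable_abse iD).
apply: le_trans (le_normr_Rintegral measurableT iD) _.
apply: le_trans (le_Rintegral measurableT iN iM (fun t _ => amgm t)) _.
rewrite RintegralD//; last exact: finite_measure_integrable_cst.
rewrite Rintegral_cst// [fine _](_ : _ = 1); last first.
  by rewrite -[RHS]/(fine 1%E); congr fine; exact: probability_setT.
rewrite mulr1 RintegralZl//.
have leE' : \int[P]_t (D t ^+ 2) <= E ^+ 2.
  by rewrite -lee_fin /Rintegral fineK//; exact: integrable_fin_num.
rewrite [leRHS](_ : E = E / 2 + (2 * E)^-1 * E ^+ 2); last first.
  by field; rewrite gt_eqF.
by rewrite lerD2l ler_wpM2l// invr_ge0 mulr_ge0// ltW.
Qed.

(** * Data matrices as Gaussian tuples *)

Section layout.
Context {R : realType} (n d : nat).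
Implicit Types th a b : 'I_n * 'I_d -> R.

(** Lists a family indexed by matrix entries in the order used by [data_of] and [gauss_exp]. The
    default 0 past the end makes [layD] hold at every index. *)
Definition lay th : nat -> R := nth 0 [seq th p | p <- enum {: 'I_n * 'I_d}].

Lemma lay_rank th p : lay th (enum_rank p) = th p.
Proof.
rewrite /lay (nth_map p) ?nth_enum_rank//.
by rewrite -cardE; exact: ltn_ord.
Qed.

Lemma layD a b : (fun i => lay a i + lay b i) = lay (fun p => a p + b p).
Proof.
apply/funext => i; rewrite /lay.
have [ltis|leis] := ltnP i (size (enum {: 'I_n * 'I_d})); last first.
  have sz (c : 'I_n * 'I_d -> R) :
      (size [seq c p | p <- enum {: 'I_n * 'I_d}] <= i)%N by rewrite size_map.
  by rewrite !(nth_default _ (sz _)) addr0.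
case E : (enum {: 'I_n * 'I_d}) ltis => [//|p0 s] ltis.
by rewrite !(nth_map p0).
Qed.

Lemma sum_lay a b :
  \sum_(i < #|{: 'I_n * 'I_d}|) lay a i * lay b i = \sum_p a p * b p.
Proof.
rewrite (reindex enum_rank) /=; last first.
  by exists enum_val => p _; [exact: enum_rankK|exact: enum_valK].
by apply: eq_bigr => p _; rewrite !lay_rank.
Qed.

Lemma data_of_tshift th (t : #|{: 'I_n * 'I_d}|.-tuple R) i j :
  data_of n d (tshift (lay th) t) i j = data_of n d t i j + th (i, j).
Proof.
rewrite !mxE -[in LHS](tnth_nth 0 (tshift (lay th) t)) tnth_mktuple.
by rewrite (tnth_nth 0) lay_rank.
Qed.

Definition data_law (mu : 'rV[R]_d) :=
  gauss_prod #|{: 'I_n * 'I_d}| (lay (fun p => mu ord0 p.2)).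

(** Bridge from iterated integrals to the measure [data_law]. One inequality suffices, since
    accuracy and sensitivity both enter as upper bounds on [gauss_exp]. *)
Lemma le_gauss_exp mu (G : 'M[R]_(n, d) -> \bar R)
    (H : #|{: 'I_n * 'I_d}|.-tuple R -> \bar R) :
  measurable_fun [set: #|{: 'I_n * 'I_d}|.-tuple R] H -> (forall t, 0 <= H t)%E ->
  (forall t, H t <= G (data_of n d (tval t)))%E ->
  (\int[data_law mu]_t H t <= gauss_exp mu G)%E.
Proof.
have e : size [seq mu ord0 p.2 | p <- enum {: 'I_n * 'I_d}] = #|{: 'I_n * 'I_d}|.
  by rewrite size_map -cardE.
rewrite /data_law /gauss_exp /lay; move: H.
set ms := [seq _ | _ <- _] in e *.
(* Eliminating the equality of lengths gives [H] the tuple type expected by [le_gauss_int]. *)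
case: _ / e => H; exact: (@le_gauss_int _ _ (fun xs => G (data_of n d xs))).
Qed.

Lemma gauss_exp_ge0 mu (G : 'M[R]_(n, d) -> \bar R) :
  (forall X, 0 <= G X)%E -> (0 <= gauss_exp mu G)%E.
Proof.
move=> G0; rewrite -(integral0 (data_law mu) setT).
by apply: le_gauss_exp => // t; exact: G0.
Qed.

Definition col_shift (x : R) (A : {set 'I_n}) (j : 'I_d) (p : 'I_n * 'I_d) : R :=
  if (p.1 \in A) && (p.2 == j) then - x else 0.

(** Only entries of column [j] in rows of both sets contribute, so the Gram entries reduce to counts
    of common rows. *)
Lemma sum_col_shift x y A B j :
  \sum_p col_shift x A j p * col_shift y B j p = x * y * #|A :&: B|%:R.
Proof.
rewrite -(pair_bigA _ (fun i l => col_shift x A j (i, l) * col_shift y B j (i, l)))/=.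
rewrite -sum1_card natr_sum mulr_sumr [RHS]big_mkcond; apply: eq_bigr => i _ /=.
rewrite (bigD1 j)//= big1 => [|l lj]; last first.
  by rewrite /col_shift /= (negbTE lj) !andbF mulr0.
rewrite /col_shift/= eqxx !andbT inE addr0 mulr1.
by case: (i \in A); case: (i \in B); rewrite /= ?mulrNN ?mulr0 ?mul0r.
Qed.

(** Moving the whole column is a change of mean, so the comparison law is again a data law, to which
    the accuracy hypothesis applies. *)
Lemma data_law_shift (mu : 'rV[R]_d) (x : R) j :
  (fun i => lay (fun p => mu ord0 p.2) i + lay (col_shift x [set: 'I_n]%SET j) i) =
  lay (fun p => (mu - x *: delta_mx ord0 j) ord0 p.2).
Proof.
rewrite layD; congr lay; apply/funext => -[i l] /=.
rewrite !mxE eqxx /col_shift !inE /=.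
by case: eqP => _; rewrite ?mulr1 ?mulr0 ?oppr0.
Qed.

End layout.

(** * Bias and sensitivity of an estimator *)

Section estimator.
Context {R : realType} (n d : nat) (f : 'M[R]_(n, d) -> 'rV[R]_d) (C : R).
Hypothesis mf : measurable_estimator f.
Hypothesis accf : unif_MSE_accurate C f.
Let N := #|{: 'I_n * 'I_d}|.
Let W := C * d%:R / n%:R.
Implicit Types (mu : 'rV[R]_d) (j : 'I_d) (t : N.-tuple R).

Definition err mu j (t : N.-tuple R) := f (data_of n d (tval t)) ord0 j - mu ord0 j.
Definition bias mu j := \int[data_law n mu]_t err mu j t.
Definition coord_mse mu j := \int[data_law n mu]_t (err mu j t ^+ 2).

Lemma measurable_err mu j : measurable_fun [set: N.-tuple R] (err mu j).
Proof. by apply: measurable_funB => //; exact: mf. Qed.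

Lemma mse_le mu :
  (\int[data_law n mu]_t (\sum_j err mu j t ^+ 2)%:E <= W%:E)%E.
Proof.
apply: (@le_trans _ _
  (gauss_exp mu (fun X => ((l2norm (f X - mu)) ^+ 2)%:E))); last first.
  by apply: le_trans accf; apply: ereal_sup_ubound; exists mu.
apply: le_gauss_exp => [|t|t].
- apply/measurable_EFinP; apply: measurable_sum => j.
  by apply: measurable_funX; exact: measurable_err.
- by rewrite lee_fin sumr_ge0// => j _; exact: sqr_ge0.
- rewrite lee_fin sqr_sqrtr; last by apply: sumr_ge0 => j _; exact: sqr_ge0.
  by apply: ler_sum => j _; rewrite !mxE.
Qed.

Lemma integrable_sum_err mu :
  (data_law n mu).-integrable [set: N.-tuple R] (fun t => (\sum_j err mu j t ^+ 2)%:E).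
Proof.
apply/integrableP; split.
  apply/measurable_EFinP; apply: measurable_sum => j.
  by apply: measurable_funX; exact: measurable_err.
apply: (@le_lt_trans _ _ W%:E); last by rewrite ltry.
apply: le_trans (mse_le mu); rewrite le_eqVlt; apply/orP; left; apply/eqP.
apply: eq_integral => t _; rewrite gee0_abs// lee_fin.
by apply: sumr_ge0 => j _; exact: sqr_ge0.
Qed.

Lemma integrable_err2 mu j :
  (data_law n mu).-integrable [set: N.-tuple R] (fun t => (err mu j t ^+ 2)%:E).
Proof.
apply: le_integrable (integrable_sum_err mu) => //.
  by apply/measurable_EFinP; apply: measurable_funX; exact: measurable_err.
move=> t _; rewrite !abse_EFin lee_fin !ger0_norm ?sqr_ge0//; last first.
  by apply: sumr_ge0 => i _; exact: sqr_ge0.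
by rewrite (bigD1 j)//= lerDl sumr_ge0// => i _; exact: sqr_ge0.
Qed.

Lemma sum_coord_mse_le mu : \sum_j coord_mse mu j <= W.
Proof.
rewrite /coord_mse -Rintegral_sum; last by move=> j; exact: integrable_err2.
rewrite -lee_fin /Rintegral fineK; first exact: mse_le.
exact: integrable_fin_num (integrable_sum_err mu).
Qed.

Lemma coord_mse_ge0 mu j : 0 <= coord_mse mu j.
Proof. by apply: Rintegral_ge0 => t _; exact: sqr_ge0. Qed.

Lemma mse_bound_ge0 : 0 <= W.
Proof. by apply: le_trans (sum_coord_mse_le 0); apply: sumr_ge0 => j _; exact: coord_mse_ge0. Qed.

(** The bound [1 + W] is positive and its square is at least [W], which avoids a square root. What
    matters is that it is uniform in [mu]: the grid argument divides it by the side length. *)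
Lemma err_bound mu j :
  (data_law n mu).-integrable [set: N.-tuple R] (fun t => (err mu j t)%:E) /\
  `|bias mu j| <= 1 + W.
Proof.
have W0 := mse_bound_ge0.
apply: normr_Rintegral_le_of_sq; first exact: measurable_err.
  by rewrite ltr_pwDl.
apply: (@le_trans _ _ W%:E); last by rewrite lee_fin; nra.
apply: le_trans (mse_le mu); apply: ge0_le_integral_nonmeas => t.
  by rewrite lee_fin sqr_ge0.
by rewrite lee_fin (bigD1 j)//= lerDl sumr_ge0// => i _; exact: sqr_ge0.
Qed.

Lemma normr_le_l2norm (v : 'rV[R]_d) j : `|v ord0 j| <= l2norm v.
Proof.
rewrite -sqrtr_sqr ler_sqrt; last by apply: sumr_ge0 => i _; exact: sqr_ge0.
by rewrite (bigD1 j)//= lerDl sumr_ge0// => i _; exact: sqr_ge0.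
Qed.

Lemma normr_diff_le_sens eta X X' j :
  Posz (hamming X X') <= Num.floor (eta * n%:R) ->
  (`|f X ord0 j - f X' ord0 j|%:E <= sens f eta X)%E.
Proof.
move=> hXX'; apply: (@le_trans _ _ (l2norm (f X - f X'))%:E).
  by rewrite lee_fin; have := normr_le_l2norm (f X - f X') j; rewrite !mxE.
by apply: ereal_sup_ubound; exists X'.
Qed.

Lemma hamming_col_shift x (A : {set 'I_n}) j (t : N.-tuple R) :
  (hamming (data_of n d (tval t))
           (data_of n d (tval (tshift (lay (col_shift x A j)) t))) <= #|A|)%N.
Proof.
apply: subset_leq_card; apply/fintype.subsetP => i.
rewrite inE/=; apply: contraTT => iA; rewrite negbK; apply/eqP/rowP => l.
by rewrite [LHS]mxE [RHS]mxE data_of_tshift /col_shift /= (negbTE iA) addr0.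
Qed.

(** The shift changes at most [#|A|] rows, so pointwise the error changes by at most the
    sensitivity, whose second moment is at most [E^2]. *)
Lemma shift_gap eta E mu j x (A : {set 'I_n}) :
  0 < E -> (ES2 f eta mu <= E%:E)%E ->
  Posz #|A| <= Num.floor (eta * n%:R) ->
  bias mu j - E <=
  \int[data_law n mu]_t err mu j (tshift (lay (col_shift x A j)) t).
Proof.
move=> E0 leE hA; set s := tshift _.
have ms : measurable_fun [set: N.-tuple R] (fun t => err mu j (s t)).
  by apply: measurableT_comp; [exact: measurable_err|exact: measurable_tshift].
have [ierr _] := err_bound mu j.
have is_ : (data_law n mu).-integrable [set: N.-tuple R] (fun t => (err mu j (s t))%:E).
  by apply: integrable_tshift; [exact: measurable_err|exact: integrable_err2].
suff [_ ] : (data_law n mu).-integrable [set: N.-tuple R]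
    (fun t => (err mu j t - err mu j (s t))%:E) /\
    `|\int[data_law n mu]_t (err mu j t - err mu j (s t))| <= E.
  by rewrite RintegralB// => /(le_trans (ler_norm _)); rewrite /bias; lra.
apply: normr_Rintegral_le_of_sq => //.
  by apply: measurable_funB => //; exact: measurable_err.
apply: (@le_trans _ _ (gauss_exp mu (fun X => (sens f eta X ^+ 2)%E))).
  apply: le_gauss_exp => [|t|t].
  - apply/measurable_EFinP; apply: measurable_funX.
    by apply: measurable_funB => //; exact: measurable_err.
  - by rewrite lee_fin sqr_ge0.
  - rewrite -real_normK ?num_real// EFin_expe.
    have le1 : (`|err mu j t - err mu j (s t)|%:E <= sens f eta (data_of n d (tval t)))%E.
      rewrite /err opprB addrA subrK; apply: normr_diff_le_sens.
      by apply: le_trans hA; rewrite lez_nat; exact: hamming_col_shift.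
    by rewrite lee_sqr// (le_trans _ le1).
(* The expectation is the square of [ES2], so the hypothesis on [ES2] can be squared. *)
rewrite -(sqr_sqrte (x := gauss_exp _ _)); last first.
  by apply: gauss_exp_ge0 => X; exact: sqre_ge0.
rewrite EFin_expe lee_sqr ?sqrte_ge0//.
by rewrite lee_fin ltW.
Qed.
End estimator.

(** * Chi-square comparison of the row moves with the full shift *)

Section mixture.
Context {R : realType} (n d k g : nat) (r : 'I_n -> 'I_k) (q : 'I_n -> 'I_g).
Hypothesis rq_inj : injective (fun i => (r i, q i)).
Variables (delta : R) (j : 'I_d).
Hypotheses (g_gt0 : (0 < g)%N) (k_le_g : (k <= g)%N) (n_le : (n <= k * g)%N)
  (n_ge : (k * g.-1 <= n)%N).
Hypotheses (delta_small : delta ^+ 2 <= 1 / 4) (g_large : 1 / g%:R <= delta ^+ 2).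
Let T := {ffun 'I_k -> 'I_g}.

(* [Some a] moves one row per group and is averaged over [a]; [None] moves every
   row by the mean displacement and is subtracted. *)
Definition mix_shift (x : option T) : 'I_n * 'I_d -> R :=
  if x is Some a then col_shift delta (transv r q a) j
  else col_shift (delta / g%:R) [set: 'I_n]%SET j.

Definition mix_coef (x : option T) : R :=
  if x is Some _ then #|{: T}|%:R^-1 else -1.

(** This is the squared norm of the averaged likelihood ratio of the row moves minus that of the
    full shift. It expands into the full shift with itself, cross terms bounded below through the
    mean size of a selection, and pairs of selections bounded above through their agreements. *)
Lemma mix_norm_le :
  \sum_x \sum_y mix_coef x * mix_coef y *
    expR (\sum_(i < #|{: 'I_n * 'I_d}|) lay (mix_shift x) i * lay (mix_shift y) i)
  <= 10 * (k%:R / g%:R) * (delta ^+ 2) ^+ 2.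
Proof.
have g0 : 0 < g%:R :> R by rewrite ltr0n.
have T0 : 0 < #|{: T}|%:R :> R by rewrite ltr0n card_ffun !card_ord expn_gt0 g_gt0.
have Tn0 := lt0r_neq0 T0; have gn0 := lt0r_neq0 g0.
set s := delta ^+ 2; set tau := #|{: T}|%:R in T0 Tn0 *.
pose e0 (a : T) := expR (s / g%:R * #|transv r q a|%:R).
pose e1 (a b : T) := expR (s * #|transv r q a :&: transv r q b|%:R).
have -> : \sum_x \sum_y mix_coef x * mix_coef y *
    expR (\sum_(i < #|{: 'I_n * 'I_d}|) lay (mix_shift x) i * lay (mix_shift y) i) =
    expR (n%:R * s / g%:R ^+ 2) - 2 * (tau^-1 * \sum_a e0 a) +
    tau^-1 ^+ 2 * \sum_a \sum_b e1 a b.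
  rewrite !big_option /=.
  under [X in _ + X]eq_bigr do rewrite big_option /=.
  rewrite big_split /= !sum_lay !sum_col_shift finset.setIT cardsT card_ord.
  have E0 a : expR (\sum_(i < #|{: 'I_n * 'I_d}|)
      lay (col_shift (delta / g%:R) [set: 'I_n]%SET j) i *
      lay (col_shift delta (transv r q a) j) i) = e0 a.
    by rewrite sum_lay sum_col_shift finset.setTI /e0 /s; congr expR; field.
  have E0' a : expR (\sum_(i < #|{: 'I_n * 'I_d}|)
      lay (col_shift delta (transv r q a) j) i *
      lay (col_shift (delta / g%:R) [set: 'I_n]%SET j) i) = e0 a.
    by rewrite sum_lay sum_col_shift finset.setIT /e0 /s; congr expR; field.
  have E1 a b : expR (\sum_(i < #|{: 'I_n * 'I_d}|)
      lay (col_shift delta (transv r q a) j) i *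
      lay (col_shift delta (transv r q b) j) i) = e1 a b.
    by rewrite sum_lay sum_col_shift /e1 /s expr2.
  under eq_bigr do rewrite E0.
  under [X in _ + (X + _)]eq_bigr do rewrite E0'.
  under [X in _ + (_ + X)]eq_bigr do (under eq_bigr do rewrite E1).
  rewrite -!mulr_sumr.
  under [X in _ + (_ + X)]eq_bigr do rewrite -mulr_sumr.
  rewrite -mulr_sumr.
  rewrite (_ : delta / g%:R * (delta / g%:R) * n%:R = n%:R * s / g%:R ^+ 2); last first.
    by rewrite /s; field.
  by rewrite -/tau; ring.
(* The exponential is bounded below by its tangent, and a selection has [n / g] rows on average. *)
have he0 : 1 + n%:R * s / g%:R ^+ 2 <= tau^-1 * \sum_a e0 a.
  apply: (@le_trans _ _
    (tau^-1 * \sum_(a : T) (1 + s / g%:R * #|transv r q a|%:R))); last first.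
    rewrite ler_wpM2l ?invr_ge0 ?(ltW T0)//.
    by apply: ler_sum => a _; exact: expR_ge1Dx.
  have cS : (\sum_(a : T) #|transv r q a|%:R) * g%:R = n%:R * tau.
    have /(congr1 (fun x => x%:R : R)) := sum_card_transv r q.
    by rewrite !natrM natr_sum !card_ord.
  rewrite big_split/= -mulr_sumr (_ : \sum_(a : T) 1 = tau); last by rewrite sumr_const.
  have -> : \sum_(a : T) #|transv r q a|%:R = n%:R * tau / g%:R :> R.
    by rewrite -cS mulfK.
  rewrite le_eqVlt; apply/orP; left; apply/eqP.
  by field; rewrite gn0.
(* Since [tau = g^k], normalising [sum_exp_agree] leaves the k-th power of [1 + (expR s - 1) / g],
   which is at most an exponential. *)
have he1 : tau^-1 ^+ 2 * \sum_a \sum_b e1 a b <= expR (k%:R / g%:R * (expR s - 1)).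
  apply: (@le_trans _ _ (tau^-1 ^+ 2 * (tau * (g%:R + (expR s - 1)) ^+ k))).
    rewrite ler_wpM2l ?sqr_ge0//.
    have := sum_exp_agree 'I_k 'I_g s; rewrite !card_ord => <-.
    apply: ler_sum => a _; apply: ler_sum => b _.
    by rewrite ler_expR ler_wpM2l ?sqr_ge0// ler_nat; exact: card_transvI.
  have tauE : tau = g%:R ^+ k by rewrite /tau card_ffun !card_ord natrX.
  have -> : tau^-1 ^+ 2 * (tau * (g%:R + (expR s - 1)) ^+ k) =
      (1 + (expR s - 1) / g%:R) ^+ k.
    rewrite (_ : 1 + (expR s - 1) / g%:R = (g%:R + (expR s - 1)) / g%:R); last by field.
    by rewrite expr_div_n -tauE; field.
  rewrite (_ : k%:R / g%:R * (expR s - 1) = k%:R * ((expR s - 1) / g%:R)); last by field.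
  rewrite expRM_natl.
  by rewrite lerXn2r ?nnegrE ?expR_ge0 ?expR_ge1Dx// addr_ge0// divr_ge0 ?(ltW g0)//
    subr_ge0 -expR0 ler_expR sqr_ge0.
apply: le_trans (_ : _ <= expR (n%:R * s / g%:R ^+ 2) - 2 * (1 + n%:R * s / g%:R ^+ 2) +
    expR (k%:R / g%:R * (expR s - 1))) _; first by lra.
apply: mix_exp_bound => //.
- by rewrite sqr_ge0.
- by rewrite ler_nat.
- rewrite (_ : g%:R - 1 = g.-1%:R) -?natrM ?ler_nat//.
  by rewrite -[in LHS](prednK g_gt0) -natr1 addrK.
- by rewrite -natrM ler_nat.
Qed.
End mixture.

(** [sum_Rintegral_tshift_le] is applied to the error at [mu]. The averaged row moves keep the mean
    error above [bias f mu j - E], the full shift gives the bias at the moved mean minus [h], and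
    [mix_norm_le] bounds the norm of the difference. *)
Lemma bias_step (R : realType) (n d k g : nat) (f : 'M[R]_(n, d) -> 'rV[R]_d)
    (C delta eta E lam : R) (r : 'I_n -> 'I_k) (q : 'I_n -> 'I_g)
    (mu : 'rV[R]_d) (j : 'I_d) :
  measurable_estimator f -> unif_MSE_accurate C f ->
  injective (fun i => (r i, q i)) ->
  (0 < g)%N -> (k <= g)%N -> (n <= k * g)%N -> (k * g.-1 <= n)%N ->
  delta ^+ 2 <= 1 / 4 -> 1 / g%:R <= delta ^+ 2 ->
  0 < E -> (ES2 f eta mu <= E%:E)%E -> Posz k <= Num.floor (eta * n%:R) ->
  0 < lam ->
  delta / g%:R + bias f mu j - bias f (mu - (delta / g%:R) *: delta_mx ord0 j) j <=
  E + 10 * (k%:R / g%:R) * (delta ^+ 2) ^+ 2 / (2 * lam) + lam / 2 * coord_mse f mu j.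
Proof.
move=> mf accf rq g0 kg nle nge ds gl E0 leE hk lam0.
set h := delta / g%:R.
have T0 : (0 < #|{ffun 'I_k -> 'I_g}|)%N by rewrite card_ffun !card_ord expn_gt0 g0.
have := sum_Rintegral_tshift_le (measurable_err mf mu j) (integrable_err2 mf accf mu j)
  (@mix_coef R k g) (fun x => lay (mix_shift r q delta j x)) lam0.
have norm_le := mix_norm_le rq j g0 kg nle nge ds gl.
set V := \sum_x \sum_y _ in norm_le *.
have V_le : V / (2 * lam) <= 10 * (k%:R / g%:R) * (delta ^+ 2) ^+ 2 / (2 * lam).
  by rewrite ler_wpM2r// invr_ge0 mulr_ge0// ltW.
rewrite big_option /=.
have -> : \int[data_law n mu]_t
    err f mu j (tshift (lay (col_shift h [set: 'I_n]%SET j)) t) =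
    bias f (mu - h *: delta_mx ord0 j) j - h.
  have [ierr _] := err_bound mf accf (mu - h *: delta_mx ord0 j) j.
  rewrite /Rintegral -(@integral_gauss_prod_shift _ _ _ _ (EFin \o err f mu j)); last first.
    by apply/measurable_EFinP; exact: measurable_err.
  rewrite data_law_shift
    -[fine _]/(\int[data_law n (mu - h *: delta_mx ord0 j)]_t err f mu j t).
  (* Recentering the error at the moved mean costs exactly [h]. *)
  have -> : err f mu j = fun t => err f (mu - h *: delta_mx ord0 j) j t - h.
    by apply/funext => t; rewrite /err !mxE !eqxx /= mulr1 opprB addrA addrAC addrK.
  rewrite RintegralB//; last exact: finite_measure_integrable_cst.
  rewrite Rintegral_cst// [fine _](_ : _ = 1) ?mulr1//.
  by rewrite -[RHS]/(fine 1%E); congr fine; exact: probability_setT.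
have gap : bias f mu j - E <=
    \sum_(a : {ffun 'I_k -> 'I_g}) #|{ffun 'I_k -> 'I_g}|%:R^-1 *
    \int[data_law n mu]_t
      err f mu j (tshift (lay (col_shift delta (transv r q a) j)) t).
  have -> : bias f mu j - E = \sum_(a : {ffun 'I_k -> 'I_g})
      #|{ffun 'I_k -> 'I_g}|%:R^-1 * (bias f mu j - E).
    rewrite sumr_const -mulrnAl -(mulr_natl _^-1) divff ?mul1r//.
    by rewrite pnatr_eq0 -lt0n.
  apply: ler_sum => a _; rewrite ler_wpM2l ?invr_ge0 ?ler0n//.
  apply: (shift_gap mf accf j delta E0 leE).
  apply: le_trans hk; rewrite lez_nat.
  by have := card_transv rq a; rewrite card_ord.
rewrite /coord_mse -/(data_law n mu) in gap *.
set Sa := \sum_(a : {ffun 'I_k -> 'I_g}) _ in gap *.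
lra.
Qed.

(** * Averaging the step inequality over a grid *)

Section grid.
Variables (R : realType) (d : nat).

(* A cyclic permutation of the [j]-th grid coordinate is the translation by
   [- h e_j] except on the face [z j = 0], a fraction [1 / (N + 1)] of the grid. *)
Lemma sum_cyclic_diff_ge (F : 'rV[R]_d -> R) (h B : R) (N : nat) (j : 'I_d) :
  (forall mu, `|F mu| <= B) ->
  - (2 * B * #|{ffun 'I_d -> 'I_N.+1}|%:R / N.+1%:R) <=
  \sum_(z : {ffun 'I_d -> 'I_N.+1})
    (F (\row_i (h * (z i)%:R)) - F (\row_i (h * (z i)%:R) - h *: delta_mx ord0 j)).
Proof.
move=> FB; pose pt (z : {ffun 'I_d -> 'I_N.+1}) : 'rV[R]_d := \row_i (h * (z i)%:R).
pose cyc (z : {ffun 'I_d -> 'I_N.+1}) : {ffun 'I_d -> 'I_N.+1} :=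
  [ffun i => if i == j then ord_pred (z i) else z i].
have cyc_inj : injective cyc.
  move=> z z' /ffunP zz'; apply/ffunP => i; have := zz' i; rewrite !ffunE.
  by case: ifP => // _; exact: ord_pred_inj.
rewrite -[leRHS]/(\sum_z (F (pt z) - F (pt z - h *: delta_mx ord0 j))).
(* A permutation preserves the sum of [F] over the grid; after it, the two terms cancel off the
   face. *)
rewrite sumrB (reindex_inj cyc_inj) -sumrB.
have ptE (z : {ffun 'I_d -> 'I_N.+1}) :
    z j != ord0 -> pt (cyc z) = pt z - h *: delta_mx ord0 j.
  move=> zj; apply/rowP => i; rewrite !mxE ffunE eqxx /=.
  case: eqVneq => [->|_]; last by rewrite mulr0 subr0.
  have zj0 : (0 < z j)%N by rewrite lt0n.
  rewrite mulr1 -[h in X in _ = _ - X]mulr1 -mulrBr; congr (_ * _).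
  rewrite /= -{1}(prednK zj0) addSn /= modnDr modn_small; last first.
    by rewrite prednK// ltnW.
  by rewrite -[in RHS](prednK zj0) -natr1 addrK.
have B0 : 0 <= B by apply: le_trans (FB 0); exact: normr_ge0.
have card0 : #|[set z : {ffun 'I_d -> 'I_N.+1} | z j == ord0]%SET|%:R * N.+1%:R =
    #|{ffun 'I_d -> 'I_N.+1}|%:R :> R.
  by rewrite -(card_ffun_fix j (ord0 : 'I_N.+1)) natrM card_ord.
rewrite -card0 mulrA mulfK ?pnatr_eq0// -sum1dep_card natr_sum mulr_sumr.
rewrite -sumrN big_mkcond.
apply: ler_sum => z _; case: ifPn => [_|/ptE ->]; last by rewrite subrr.
have := FB (pt (cyc z)); have := FB (pt z - h *: delta_mx ord0 j).
by rewrite !ler_norml => /andP[? ?] /andP[? ?]; lra.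
Qed.

(** Averaged over the grid, the differences of [b] contribute at least [- 2 B / (N + 1)] in each
    direction, while the [v] terms sum to at most [W] at each point, that is [W / d] per direction.
    The side of the grid then tends to infinity. *)
Lemma mean_step_le (b v : 'rV[R]_d -> 'I_d -> R) (h B W rho lam : R) :
  (0 < d)%N -> 0 <= lam ->
  (forall mu j, `|b mu j| <= B) -> (forall mu, \sum_j v mu j <= W) ->
  (forall mu j,
    h + b mu j - b (mu - h *: delta_mx ord0 j) j <= rho + lam * v mu j) ->
  h <= rho + lam * (W / d%:R).
Proof.
move=> d0 lam0 bB vW step.
have dR : 0 < d%:R :> R by rewrite ltr0n.
have key (N : nat) : h <= rho + lam * (W / d%:R) + 2 * B / N.+1%:R.
  pose pt (z : {ffun 'I_d -> 'I_N.+1}) : 'rV[R]_d := \row_i (h * (z i)%:R).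
  set M := #|{ffun 'I_d -> 'I_N.+1}|%:R : R.
  have M0 : 0 < M by rewrite ltr0n card_ffun !card_ord expn_gt0.
  have N0 : 0 < N.+1%:R :> R by rewrite ltr0n.
  have up : \sum_z \sum_j (h + b (pt z) j - b (pt z - h *: delta_mx ord0 j) j) <=
      M * (d%:R * rho + lam * W).
    rewrite /M [leRHS]mulr_natl -sumr_const; apply: ler_sum => z _.
    apply: (@le_trans _ _ (\sum_j (rho + lam * v (pt z) j))).
      by apply: ler_sum => j _; exact: step.
    rewrite big_split/= sumr_const card_ord -mulr_sumr mulr_natl lerD2l.
    by rewrite ler_wpM2l.
  have lo : d%:R * (M * h - 2 * B * M / N.+1%:R) <=
      \sum_z \sum_j (h + b (pt z) j - b (pt z - h *: delta_mx ord0 j) j).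
    rewrite exchange_big/= mulr_natl -[d in _ *+ d]card_ord -sumr_const.
    apply: ler_sum => j _.
    under eq_bigr do rewrite -addrA.
    rewrite big_split/= sumr_const -[h *+ _]mulr_natl -/M lerD2l.
    exact: (@sum_cyclic_diff_ge (fun mu => b mu j) h B N j (fun mu => bB mu j)).
  have := le_trans lo up => {lo up}.
  have -> : d%:R * (M * h - 2 * B * M / N.+1%:R) =
      d%:R * M * (h - 2 * B / N.+1%:R) by ring.
  have -> : M * (d%:R * rho + lam * W) = d%:R * M * (rho + lam * (W / d%:R)).
    by field; rewrite gt_eqF.
  by rewrite ler_pM2l ?mulr_gt0// lerBlDr.
have B0 : 0 <= B by apply: le_trans (bB 0 (Ordinal d0)); exact: normr_ge0.
apply/ler_addgt0Pr => e e0.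
(* Large enough that [2 B / N.+1 <= e]. *)
pose N := Num.bound (2 * B / e).
apply: le_trans (key N) _; rewrite lerD2l ler_pdivrMr ?ltr0n//.
rewrite -ler_pdivrMl// mulrC.
have := archi_boundP (divr_ge0 (mulr_ge0 (ler0n _ 2) B0) (ltW e0) : 0 <= 2 * B / e).
rewrite -/N => /ltW /le_trans; apply.
by rewrite ler_nat leqnSn.
Qed.
End grid.

(** * Choice of the constants and conclusion *)

Theorem theorem3p3 (R : realType) (C_MSE : R) :
  0 < C_MSE ->
  exists (kappa c_low : R) (N0 : nat),
    0 < kappa /\ 0 < c_low /\
    forall (d n : nat) (f : 'M[R]_(n, d) -> 'rV[R]_d) (eta : R),
      (1 <= d)%N -> (N0 <= n)%N ->
      measurable_estimator f ->
      unif_MSE_accurate C_MSE f ->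
      0 < eta < 1 ->
      1 <= Num.floor (eta * n%:R) ->
      (Num.floor (eta * n%:R))%:~R <= kappa * Num.sqrt (n%:R) ->
      (ereal_sup [set ES2 f eta mu | mu in [set: 'rV[R]_d]]
         >= (c_low * eta)%:E)%E.
Proof.
move=> C0.
(* With [x = k / n], this value makes the three costs in the final comparison total [3/8] of
   [delta x], below the guaranteed shift [delta x / 2]. *)
pose delta : R := (4 * (C_MSE + 10))^-1.
have delta0 : 0 < delta by rewrite invr_gt0 mulr_gt0// addr_gt0.
have delta_eq : delta * (C_MSE + 10) = 1 / 4.
  by rewrite /delta; field; rewrite gt_eqF// addr_gt0.
pose s := delta ^+ 2; have s0 : 0 < s by rewrite exprn_gt0.
have delta_le : delta <= 1 / 40 by nra.
(* [kappa = 1] gives [k^2 <= n], [delta / 8] holds the sensitivity term to [delta x / 4], and the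
   threshold on [n] forces [1 / g <= s]. *)
exists 1, (delta / 8), (Num.bound (s^-1 ^+ 2)).
split=> //; split; first by rewrite divr_gt0.
move=> d n f eta d0 N0n mf accf /andP[eta0 eta1] fl1 flle.
have sn : s^-1 ^+ 2 < n%:R.
  have := archi_boundP (sqr_ge0 s^-1) => /lt_le_trans; apply.
  by rewrite ler_nat.
have n0 : 0 < n%:R :> R by apply: le_lt_trans sn; exact: sqr_ge0.
have [k fl_k] : exists k : nat, Num.floor (eta * n%:R) = k%:Z.
  by exists `|Num.floor (eta * n%:R)|%N; rewrite gez0_abs// (le_trans _ fl1).
have k0 : (0 < k)%N by move: fl1; rewrite fl_k lez_nat.
have kR : 1 <= k%:R :> R by rewrite ler1n.
have k2 : k%:R ^+ 2 <= n%:R :> R.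
  move: flle; rewrite fl_k mul1r => h.
  by rewrite -(sqr_sqrtr (ltW n0)) lerXn2r ?nnegrE ?sqrtr_ge0.
have k2n : (k * k <= n)%N by rewrite -(ler_nat R) natrM -expr2.
have eta_lt : eta * n%:R < 2 * k%:R.
  have := floorD1_gt (eta * n%:R); rewrite fl_k intrD /= => h.
  apply: lt_le_trans h _; lra.
(* One more than the quotient, so that [k] groups of [g] places hold all rows while
   [k (g - 1) <= n]. *)
pose g := (n %/ k).+1.
have kg : (k <= g)%N by rewrite leqW// leq_divRL.
have n_le : (n <= k * g)%N by rewrite mulnC ltnW// -ltn_divLR.
have n_ge : (k * g.-1 <= n)%N by rewrite mulnC leq_trunc_div.
have g0 : 0 < g%:R :> R by rewrite ltr0n.
have nR_le : n%:R <= k%:R * g%:R :> R by rewrite -natrM ler_nat.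
have nR_ge : k%:R * g%:R <= 2 * n%:R :> R.
  rewrite -!natrM ler_nat /g mulnS mul2n -addnn.
  by apply: leq_add n_ge; apply: leq_trans k2n; rewrite leq_pmulr.
(* Because [g^2 >= k g >= n > s^-2]. *)
have gs : 1 / g%:R <= s.
  rewrite ler_pdivrMr// -ler_pdivrMl// mulr1.
  have sg : s^-1 ^+ 2 < g%:R ^+ 2.
    apply: lt_le_trans sn _; apply: le_trans nR_le _.
    by rewrite expr2 ler_wpM2r ?(ltW g0)// ler_nat.
  by move: sg; rewrite ltr_pXn2r ?nnegrE ?invr_ge0 ?(ltW s0) ?(ltW g0)// => /ltW.
have rP (i : 'I_n) : (i %% k < k)%N by rewrite ltn_pmod.
have qP (i : 'I_n) : (i %/ k < g)%N by rewrite ltnS leq_div2r// ltnW.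
(* The group is the remainder modulo [k], the place is the quotient. *)
pose r i : 'I_k := Ordinal (rP i); pose q i : 'I_g := Ordinal (qP i).
have rq : injective (fun i => (r i, q i)).
  move=> i i' /= [rii' qii']; apply: val_inj => /=.
  by rewrite (divn_eq i k) rii' qii' -divn_eq.
(* If the conclusion fails, the sensitivity bound holds at every mean, hence the step inequality at
   every grid point. *)
rewrite leNgt; apply/negP => sup_lt.
have leE mu : (ES2 f eta mu <= (delta / 8 * eta)%:E)%E.
  by apply/ltW/le_lt_trans/sup_lt; apply: ereal_sup_ubound; exists mu.
have E0 : 0 < delta / 8 * eta by rewrite mulr_gt0// divr_gt0.
have lam0 : 0 < s * k%:R by rewrite mulr_gt0// ltr0n.
have s14 : s <= 1 / 4 by rewrite /s; nra.
(* Taking [lam = s k] in [bias_step] balances the errors: [5 s / g] from the likelihood ratios and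
   [s C_MSE k / (2 n)] from the mean square error, both smaller than [delta / g] by a factor of
   order [delta]. *)
have hle : delta / g%:R <= delta / 8 * eta +
    10 * (k%:R / g%:R) * s ^+ 2 / (2 * (s * k%:R)) +
    s * k%:R / 2 * (C_MSE * d%:R / n%:R / d%:R).
  apply: (@mean_step_le R d (bias f) (coord_mse f) _ (1 + C_MSE * d%:R / n%:R)) => //.
  - by rewrite divr_ge0// ltW.
  - by move=> mu j; have [] := err_bound mf accf mu j.
  - by move=> mu; exact: sum_coord_mse_le.
  - by move=> mu j; apply: (bias_step j mf accf rq) => //; rewrite fl_k.
have dn0 : d%:R != 0 :> R by rewrite pnatr_eq0 -lt0n.
(* The quantities [k / n] and [1 / g] agree up to a factor 2. *)
pose x := k%:R / n%:R : R; pose y := g%:R^-1 : R.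
have x0 : 0 < x by rewrite divr_gt0// ltr0n.
have y_le : y <= x by rewrite /y /x ler_pdivlMr// mulrC ler_pdivrMr.
have y_ge : x / 2 <= y.
  rewrite -(ler_pM2r (mulr_gt0 (mulr_gt0 (ltr0Sn _ 1) n0) g0)).
  rewrite (_ : x / 2 * _ = k%:R * g%:R); last by rewrite /x; field; rewrite gt_eqF.
  by rewrite (_ : y * _ = 2 * n%:R)// /y; field; rewrite gt_eqF.
have eta_x : eta < 2 * x by rewrite /x mulrA ltr_pdivlMr.
have : delta * y <= delta / 8 * eta + 5 * s * y + s * C_MSE / 2 * x.
  apply: le_trans hle _; rewrite le_eqVlt; apply/orP; left; apply/eqP.
  by rewrite /x /y; field; rewrite !gt_eqF// ?ltr0n.
apply/negP; rewrite -ltNge.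
apply: (@lt_le_trans _ _ (delta / 8 * (2 * x) + 5 * s * x + s * C_MSE / 2 * x)).
  rewrite ltrD2r ltr_leD// ?ltr_pM2l ?divr_gt0//.
  by rewrite ler_wpM2l// mulr_ge0// ltW.
have -> : delta / 8 * (2 * x) + 5 * s * x + s * C_MSE / 2 * x =
    delta * x * (1 / 4 + delta * (C_MSE + 10) / 2) by rewrite /s; field.
rewrite delta_eq; have dx0 : 0 < delta * x by rewrite mulr_gt0.
apply: (@le_trans _ _ (delta * (x / 2))); last by rewrite ler_pM2l.
by lra.
Qed.
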